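(* Let $P$ be a set of (non-empty) permutations such that every element of $\overline{P}$ is sum-indecomposable, and let $n\ge0$. Then the staircase encoding $\mathrm{SE}$ is a bijection between $\mathrm{Av}^{(n)}(2413,3142,3124,1\oplus P)$ and $\mathrm{WI}_{\rho}(\mathcal{UDC}(B_n),\mathrm{Av}^{+}(312,\overline{P}),\mathrm{Av}^{+}(2413,3142,3124,P))$.
   Context: A permutation of size $n$ is a word containing each of $1,\dots,n$ exactly once. $\sigma$ contains $\pi$ if some subsequence of $\sigma$ has the same relative order as $\pi$; otherwise it avoids $\pi$. $\mathrm{Av}(P)$ is the set of permutations avoiding every element of $P$, $\mathrm{Av}^{+}(P)$ its non-empty elements. For $\alpha$ of size $a$, $\beta$ of size $b$: $\alpha\oplus\beta=\alpha_1\cdots\alpha_a(\beta_1+a)\cdots(\beta_b+a)$; a permutation is sum-indecomposable if it is not $\alpha\oplus\beta$ with $\alpha,\beta$ non-empty. $1\oplus P=\{1\oplus\pi:\pi\in P\}$. The empty permutation is not in $P$. For a permutation $\sigma$, $\overline{\sigma}=\alpha$ if $\sigma=\alpha\oplus1$ for some permutation $\alpha$ (i.e. $\sigma$ ends with its maximum, which is removed), and $\overline{\sigma}=\sigma$ otherwise; $\overline{P}=\{\overline{\pi}:\pi\in P\}$. A left-to-right minimum of $\sigma$ is an entry $\sigma_i$ with $\sigma_j>\sigma_i$ for all $j<i$; $\mathrm{Av}^{(n)}(Q)$ is the set of permutations in $\mathrm{Av}(Q)$ with exactly $n$ left-to-right minima. $B_n=\{(i,j):1\le i\le j\le n\}$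 (row $i$, column $j$, row 1 on top). If $\sigma$ has left-to-right minima at positions $p_1<\dots<p_n$ with values $v_1>\dots>v_n$, each non-minimum entry $\sigma_k$ lies in cell $(i,j)$ where $j$ is the largest index with $p_j<k$ and $i$ the smallest index with $v_i<\sigma_k$. $\mathrm{SE}(\sigma)$ is the filling of $B_n$ putting in each cell the standardization of the entries of $\sigma$ in that cell (empty permutation if none). $\mathcal{UDC}(B_n)$ is the graph on $B_n$ in which distinct $(i,j),(k,\ell)$ are adjacent iff at least one of: $i>k$ and $j<\ell$ (or symmetrically); $i<k$, $j<\ell$ and $\{i,\dots,k\}\times\{j,\dots,\ell\}\subseteq B_n$ (or symmetrically); $j=\ell$. For an independent set $I$ and $v\in I$, $\rho(v,I)=y$ if $v$ is not the rightmost cell of $I$ in its row, and $\rho(v,I)=z$ otherwise. $\mathrm{WI}_\rho(G,Y,Z)$ is the set of fillings of $B_n$ whose set $I$ of non-empty cells is an independent set of $G$, where each $v\in I$ contains an element of $Y$ if $\rho(v,I)=y$ and of $Z$ if $\rho(v,I)=z$. ''SE is a bijection between $X$ and $W$'' means SE restricted to $X$ is injective with image exactly $W$. *)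

(* Defs.v *)
From mathcomp Require Import all_boot.
From mathcomp Require Import boolp classical_sets functions.

Set Implicit Arguments.
Unset Strict Implicit.
Unset Printing Implicit Defensive.

Local Open Scope classical_set_scope.

(* Permutations are words over nat with values 1, ..., size s; positions in a
   word are counted from 0. *)
Definition is_perm (s : seq nat) : bool := perm_eq s (iota 1 (size s)).

Definition order_iso (s t : seq nat) : Prop :=
  size s = size t /\
  forall i j, i < size s -> j < size s ->
    (nth 0 s i < nth 0 s j) = (nth 0 t i < nth 0 t j).

Definition contains (s p : seq nat) : Prop :=
  exists2 t, subseq t s & order_iso t p.

Definition Av (Q : set (seq nat)) : set (seq nat) :=
  [set s | is_perm s /\ forall p, Q p -> ~ contains s p].

Definition Avp (Q : set (seq nat)) : set (seq nat) :=
  [set s | Av Q s /\ s <> [::]].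

Definition oplus (a b : seq nat) : seq nat := a ++ [seq x + size a | x <- b].

(* With this definition the empty permutation is sum-indecomposable; it is the
   image of the one-point permutation under bar below. *)
Definition sum_indecomposable (s : seq nat) : Prop :=
  ~ exists a b, [/\ is_perm a, is_perm b, a <> [::], b <> [::] & s = oplus a b].

(* If s = oplus a [:: 1], then a is necessarily s without its last entry. *)
Definition bar (s : seq nat) : seq nat :=
  let a := take (size s).-1 s in
  if is_perm a && (s == oplus a [:: 1]) then a else s.

Definition is_lrmin (s : seq nat) (k : nat) : bool :=
  all (fun j => nth 0 s k < nth 0 s j) (iota 0 k).

Definition lrmin_pos (s : seq nat) : seq nat :=
  [seq k <- iota 0 (size s) | is_lrmin s k].

Definition lrmin_val (s : seq nat) : seq nat :=
  [seq nth 0 s k | k <- lrmin_pos s].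

Definition Avn (n : nat) (Q : set (seq nat)) : set (seq nat) :=
  [set s | Av Q s /\ size (lrmin_pos s) = n].

(* Rows and columns of B_n are indexed from 0: the pair (i, j) stands for the
   cell (i + 1, j + 1) of the staircase grid. *)
Definition inB (n : nat) (c : 'I_n * 'I_n) : bool := c.1 <= c.2.

Definition cell (n : nat) := {c : 'I_n * 'I_n | inB c}.

Definition crow (n : nat) (c : cell n) : 'I_n := (val c).1.
Definition ccol (n : nat) (c : cell n) : 'I_n := (val c).2.

Definition filling (n : nat) := {ffun cell n -> seq nat}.

(* For a position k that is not a left-to-right minimum, both index sets below
   are non-empty. *)
Definition entry_col (s : seq nat) (k : nat) : nat :=
  \max_(j < size (lrmin_pos s) | nth 0 (lrmin_pos s) j < k) j.

Definition entry_row (s : seq nat) (k : nat) : nat :=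
  find (fun v => v < nth 0 s k) (lrmin_val s).

Definition cell_entries (s : seq nat) (i j : nat) : seq nat :=
  [seq nth 0 s k | k <- iota 0 (size s)
    & [&& ~~ is_lrmin s k, entry_row s k == i & entry_col s k == j]].

Definition standardize (s : seq nat) : seq nat :=
  [seq (count (fun y => y < x) s).+1 | x <- s].

(* Meaningful for permutations s with exactly n left-to-right minima. *)
Definition SE (n : nat) (s : seq nat) : filling n :=
  [ffun c : cell n => standardize (cell_entries s (crow c) (ccol c))].

Definition rect_inB (n : nat) (i k j l : 'I_n) : bool :=
  [forall a : 'I_n, forall b : 'I_n,
    (i <= a <= k) && (j <= b <= l) ==> inB (a, b)].

Definition up_adj (n : nat) (c d : cell n) : bool :=
  (crow d < crow c) && (ccol c < ccol d).

Definition down_adj (n : nat) (c d : cell n) : bool :=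
  [&& crow c < crow d, ccol c < ccol d &
      rect_inB (crow c) (crow d) (ccol c) (ccol d)].

Definition UDC (n : nat) : rel (cell n) :=
  fun c d => (c != d) &&
    [|| up_adj c d, up_adj d c, down_adj c d, down_adj d c
      | ccol c == ccol d].

Definition independent (T : finType) (e : rel T) (I : {set T}) : Prop :=
  forall u v, u \in I -> v \in I -> ~~ e u v.

Inductive label := LabelY | LabelZ.

Definition rho (n : nat) (v : cell n) (I : {set cell n}) : label :=
  if [exists u in I, (crow u == crow v) && (ccol v < ccol u)]
  then LabelY else LabelZ.

Definition nonempty_cells (n : nat) (w : filling n) : {set cell n} :=
  [set c | w c != [::]]%SET.

Definition WI (n : nat) (r : cell n -> {set cell n} -> label) (G : rel (cell n))
    (Y Z : set (seq nat)) : set (filling n) :=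
  [set w | independent G (nonempty_cells w) /\
    forall v, v \in nonempty_cells w ->
      match r v (nonempty_cells w) with
      | LabelY => Y (w v)
      | LabelZ => Z (w v)
      end].

(* Main.v *)
Require Import Defs.
From mathcomp Require Import all_boot all_order.
From mathcomp Require Import zify.
From mathcomp Require Import boolp classical_sets functions.

(** Two cells are adjacent in the graph exactly when they lie in different rows and
    some left-to-right minimum is below and to the left of both. So the non-empty cells
    of the encoding are independent iff all entries above and to the right of a given
    minimum lie in one row. Avoiding 3142 and 3124 forces this, and avoiding 2413 forces
    each row to increase from cell to cell. For a permutation with these two properties,
    called a staircase below, the cell of every entry and the contents of the cells
    determine the order of all positions and of all values, whence a bijection with the
    fillings whose non-empty cells are independent. In a staircase, an occurrence of
    2413, 3142 or 3124 stays in one row, and [1 (+) p] occurs iff [p] occurs inside one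
    row. A row is a direct sum of its cells and [bar p] is sum-indecomposable, so [p]
    occurs in a row iff some cell contains [p], or some cell that is not the last of its
    row contains [bar p]; the last entry of [p] is then found in a later cell. The bars
    of 2413, 3142 and 3124 are 2413, 3142 and 312, so all forbidden patterns are covered
    by this one argument. *)

Set Implicit Arguments.
Unset Strict Implicit.
Unset Printing Implicit Defensive.

Import Order.TTheory.
Local Open Scope classical_set_scope.

(** * Strictly sorted sequences *)

Section StrictlySorted.
Variables (T : eqType) (r : rel T).
Hypotheses (r_trans : transitive r) (r_irr : irreflexive r).

Lemma sorted_sub_subseq (s t : seq T) :
  sorted r s -> sorted r t -> {subset s <= t} -> subseq s t.
Proof.
move=> sorted_s sorted_t sub.
suff -> : s = [seq x <- t | x \in s] by exact: filter_subseq.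
apply: (irr_sorted_eq r_trans r_irr sorted_s); first exact: sorted_filter.
by move=> x; rewrite mem_filter andb_idr // => /sub.
Qed.

Lemma sorted_filterID (a : pred T) (s : seq T) : sorted r s ->
  {in s &, forall x y, r x y -> a y -> a x} ->
  s = [seq x <- s | a x] ++ [seq x <- s | ~~ a x].
Proof.
elim: s => //= x s IH /[dup] /path_sorted sorted_s.
move=> /(order_path_min r_trans)/allP x_min down.
case: ifP => [_|ax] /=.
  congr (_ :: _); apply: IH => // y z ys zs.
  by apply: down; rewrite inE ?ys ?zs orbT.
have not_a y : y \in s -> ~~ a y.
  move=> ys; apply: contraFN ax.
  by apply: down (x_min y ys); rewrite !inE ?eqxx ?ys ?orbT.
rewrite (@eq_in_filter _ _ pred0) ?filter_pred0 => [|y /not_a/negbTE//].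
by have /all_filterP-> : all (fun y => ~~ a y) s by apply/allP.
Qed.

End StrictlySorted.

(** * Standardization *)

Definition rank d (T : orderType d) (t : seq T) (x : T) : nat := count (< x)%O t.

Lemma ltn_rank d (T : orderType d) (t : seq T) :
  {in t &, {mono rank t : x y / (x < y)%O >-> x < y}}.
Proof.
move=> x y xt _; rewrite /rank; have [lt_xy|le_yx] := ltP x y; last first.
  by rewrite ltnNge; apply/negbF/sub_count => z /= zy; apply: lt_le_trans le_yx.
have: 0 < count_mem x t by rewrite -has_count has_pred1.
suff: count (< x)%O t + count_mem x t <= count (< y)%O t by lia.
rewrite -count_predUI [X in _ + X](@eq_count _ _ pred0) => [|z] /=.
  rewrite count_pred0 addn0; apply: sub_count => z /= /orP[zx|/eqP->] //.
  exact: lt_trans lt_xy.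
by have [->|] := eqVneq z x; rewrite ?ltxx ?andbF.
Qed.

Lemma rank_inj d (T : orderType d) (t : seq T) : {in t &, injective (rank t)}.
Proof.
move=> x y xt yt eq_rank; apply/eqP; rewrite eq_le !leNgt.
by rewrite -(ltn_rank xt yt) -(ltn_rank yt xt) eq_rank ltnn.
Qed.

Lemma standardizeE t : standardize t = [seq (rank t x).+1 | x <- t].
Proof. by []. Qed.

Lemma size_standardize t : size (standardize t) = size t.
Proof. exact: size_map. Qed.

Lemma standardize1 x : standardize [:: x] = [:: 1].
Proof. by rewrite /standardize /= ltnn. Qed.

Lemma eq_standardize (T : eqType) (f g : T -> nat) (r : seq T) :
  {in r &, forall x y, (f x < f y) = (g x < g y)} ->
  standardize [seq f x | x <- r] = standardize [seq g x | x <- r].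
Proof.
move=> eq_fg; rewrite /standardize -!map_comp; apply/eq_in_map => x xr /=.
by rewrite !count_map; congr _.+1; apply: eq_in_count => y yr; apply: eq_fg.
Qed.

Lemma standardize_map (g : nat -> nat) t :
  {in t &, {mono g : x y / x < y}} -> standardize [seq g x | x <- t] = standardize t.
Proof. by rewrite -[in RHS](map_id t); apply: eq_standardize. Qed.

Lemma ltn_nth_standardize t i j : i < size t -> j < size t ->
  (nth 0 (standardize t) i < nth 0 (standardize t) j) = (nth 0 t i < nth 0 t j).
Proof. by move=> it jt; rewrite standardizeE !(nth_map 0) // ltnS ltn_rank ?mem_nth. Qed.

Lemma standardize_map_rank t u : {subset u <= t} ->
  standardize [seq (rank t x).+1 | x <- u] = standardize u.
Proof.
by move=> ut; apply: standardize_map => x y /ut xt /ut yt; rewrite ltnS ltn_rank.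
Qed.

Lemma standardize_mask m t :
  standardize (mask m (standardize t)) = standardize (mask m t).
Proof.
by rewrite [standardize t]standardizeE -map_mask standardize_map_rank // => x /mem_mask.
Qed.

Lemma order_isoE s t : order_iso s t <-> standardize s = standardize t.
Proof.
split=> [[eq_sz iso]|eq_std].
  rewrite -(mkseq_nth 0 s) -(mkseq_nth 0 t) /mkseq -eq_sz; apply: eq_standardize => i j.
  by rewrite !mem_iota => si sj; apply: iso.
have eq_sz : size s = size t by rewrite -size_standardize eq_std size_standardize.
split=> // i j si sj.
by rewrite -ltn_nth_standardize // eq_std ltn_nth_standardize -?eq_sz.
Qed.

Lemma is_perm_uniq s : is_perm s -> uniq s.
Proof. by move/perm_uniq->; apply: iota_uniq. Qed.

Lemma mem_is_perm s x : is_perm s -> (x \in s) = (0 < x <= size s).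
Proof. by move/perm_mem->; rewrite mem_iota add1n. Qed.

Lemma is_perm_standardize t : uniq t -> is_perm (standardize t).
Proof.
move=> ut; have u_std : uniq (standardize t).
  by rewrite standardizeE map_inj_in_uniq // => x y xt yt [] /(rank_inj xt yt).
apply: uniq_perm; rewrite ?iota_uniq //; apply: (uniq_min_size u_std _ _).2.
  move=> _ /mapP[y yt ->]; rewrite size_standardize mem_iota /= add1n ltnS.
  rewrite -(count_predC (ltn^~ y) t) -[X in X < _]addn0 ltn_add2l -has_count.
  by apply/hasP; exists y => //=; rewrite ltnn.
by rewrite size_iota.
Qed.

Lemma standardize_id s : is_perm s -> standardize s = s.
Proof.
move=> perm_s; rewrite -[RHS]map_id; apply/eq_in_map => x.
rewrite mem_is_perm // => /andP[x_gt0 x_le]; rewrite (permP perm_s).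
have x_lt : x.-1 < size (iota 1 (size s)) by rewrite size_iota prednK.
have := count_lt_nth 0 (iota_ltn_sorted 1 (size s)) x_lt.
by rewrite nth_iota ?add1n ?prednK // => ->; rewrite prednK.
Qed.

(** * Direct sums *)

Definition separated (a b : seq nat) : Prop := {in a & b, forall x y, x < y}.

Lemma standardize_cat a b : separated a b ->
  standardize (a ++ b) = oplus (standardize a) (standardize b).
Proof.
move=> sep; rewrite /standardize /oplus map_cat -map_comp size_map.
congr (_ ++ _); apply/eq_in_map => x xab /=; rewrite count_cat.
  rewrite [X in _ + X](@eq_in_count _ _ pred0) ?count_pred0 ?addn0 // => y yb /=.
  by apply/negbTE; rewrite -leqNgt ltnW // sep.
rewrite [X in X + _](@eq_in_count _ _ predT) ?count_predT ?addSn 1?addnC // => y ya /=.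
by rewrite sep.
Qed.

Lemma separated_oplus a b : is_perm a -> is_perm b ->
  separated a [seq x + size a | x <- b].
Proof.
move=> perm_a perm_b x _ xa /mapP[y yb ->].
by move: xa yb; rewrite !mem_is_perm //; lia.
Qed.

Lemma is_perm_oplus a b : is_perm a -> is_perm b -> is_perm (oplus a b).
Proof.
move=> perm_a perm_b; have sep := separated_oplus perm_a perm_b.
suff <- : standardize (oplus a b) = oplus a b.
  apply: is_perm_standardize; rewrite cat_uniq map_inj_uniq; last exact: addIn.
  rewrite !is_perm_uniq // andbT; apply/hasPn => x xb.
  by apply/negP => /sep /(_ xb); rewrite ltnn.
rewrite standardize_cat // standardize_map ?standardize_id // => x y _ _.
by rewrite ltn_add2r.
Qed.

Lemma standardize_eq_oplus t a b : is_perm a -> is_perm b -> standardize t = oplus a b ->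
  [/\ standardize (take (size a) t) = a, standardize (drop (size a) t) = b &
      separated (take (size a) t) (drop (size a) t)].
Proof.
move=> perm_a perm_b; rewrite standardizeE => std_t.
have take_t : [seq (rank t x).+1 | x <- take (size a) t] = a.
  by rewrite map_take std_t take_size_cat.
have drop_t : [seq (rank t x).+1 | x <- drop (size a) t] = [seq x + size a | x <- b].
  by rewrite map_drop std_t drop_size_cat.
split=> [||x y xt yt].
- rewrite -(standardize_map_rank (t := t)) => [|x /mem_take//].
  by rewrite take_t standardize_id.
- rewrite -(standardize_map_rank (t := t)) => [|x /mem_drop//]; rewrite drop_t.
  by rewrite standardize_map ?standardize_id // => x y _ _; rewrite ltn_add2r.
- have := map_f (fun z => (rank t z).+1) xt; rewrite take_t => xa.
  have := map_f (fun z => (rank t z).+1) yt; rewrite drop_t => yb.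
  have := separated_oplus perm_a perm_b xa yb.
  by rewrite ltnS (ltn_rank (mem_take xt) (mem_drop yt)).
Qed.

Lemma sum_indecomposable_cat a b : uniq (a ++ b) -> separated a b ->
  sum_indecomposable (standardize (a ++ b)) -> a = [::] \/ b = [::].
Proof.
rewrite cat_uniq => /and3P[u_a _ u_b] sep indec.
case: a => [|x a] in u_a sep indec *; first by left.
case: b => [|y b] in u_b sep indec *; first by right.
case: indec; exists (standardize (x :: a)), (standardize (y :: b)).
by rewrite standardize_cat //; split; rewrite ?is_perm_standardize.
Qed.

Lemma sum_indecomposable_take p :
  all (fun i => ~~ is_perm (take i p)) (iota 1 (size p).-1) -> sum_indecomposable p.
Proof.
move=> /allP not_perm [a [b [perm_a _ a_neq0 b_neq0 p_ab]]].
have : size a \in iota 1 (size p).-1.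
  rewrite p_ab size_cat size_map mem_iota.
  by case: a b a_neq0 b_neq0 {perm_a p_ab} => [|? ?] [|? ?] //=; lia.
by move/not_perm; rewrite p_ab take_size_cat // perm_a.
Qed.

Lemma barP p : bar p = p \/ is_perm (bar p) /\ p = oplus (bar p) [:: 1].
Proof.
rewrite /bar; case: ifP => [/andP[perm_a /eqP p_eq]|_]; last by left.
by right.
Qed.

Lemma is_perm_bar p : is_perm p -> is_perm (bar p).
Proof. by case: (barP p) => [->|[]]. Qed.

Lemma standardize_take_bar t :
  standardize (take (size (bar (standardize t))) t) = bar (standardize t).
Proof.
have [->|[perm_bar std]] := barP (standardize t).
  by rewrite size_standardize take_size.
by have [] := standardize_eq_oplus perm_bar _ std.
Qed.

(** * Occurrences of patterns *)

Definition occurs_in (s : seq nat) (D : pred nat) (p : seq nat) : Prop :=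
  exists ks, [/\ sorted ltn ks, all D ks & standardize [seq nth 0 s k | k <- ks] = p].

Lemma containsE s p :
  is_perm p -> contains s p <-> exists2 t, subseq t s & standardize t = p.
Proof.
move=> perm_p; split=> -[t sub_t std]; exists t => //.
  by move/order_isoE: std => ->; apply: standardize_id.
by apply/order_isoE; rewrite std standardize_id.
Qed.

Lemma contains_standardize t p : contains (standardize t) p <-> contains t p.
Proof.
split=> -[_ /subseqP[m sz_m ->] iso].
  exists (mask m t); first exact: mask_subseq.
  by apply/order_isoE; rewrite -standardize_mask; apply/order_isoE.
exists (mask m (standardize t)); first exact: mask_subseq.
by apply/order_isoE; rewrite standardize_mask; apply/order_isoE.
Qed.

Lemma contains_trans s q p : contains s q -> contains q p -> contains s p.
Proof.
move=> [t sub_t /order_isoE std_t] /contains_standardize; rewrite -std_t.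
move=> /contains_standardize[u sub_u iso]; exists u => //.
exact: subseq_trans sub_u sub_t.
Qed.

Lemma contains_nths s js p : is_perm p -> sorted ltn js ->
  contains [seq nth 0 s k | k <- js] p <-> occurs_in s [in js] p.
Proof.
move=> perm_p sorted_js; rewrite containsE //; split.
  move=> [_ /subseqP[m _ ->]]; rewrite -map_mask => std; exists (mask m js); split=> //.
    exact: (subseq_sorted ltn_trans (mask_subseq _ _)).
  by apply/allP => k /mem_mask.
move=> [ks [sorted_ks /allP ks_js std]]; exists [seq nth 0 s k | k <- ks] => //.
exact/map_subseq/(sorted_sub_subseq ltn_trans ltnn).
Qed.

Lemma contains_occurs s p : is_perm p -> contains s p <-> occurs_in s (gtn (size s)) p.
Proof.
move=> perm_p; rewrite -[X in contains X](mkseq_nth 0) contains_nths ?iota_ltn_sorted //.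
split=> -[ks [sorted_ks in_D std]]; exists ks; split=> //;
  by apply: sub_all in_D => k /=; rewrite mem_iota.
Qed.

Lemma contains4P s p : is_perm p -> size p = 4 ->
  contains s p <-> exists a b c d, [&& a < b, b < c, c < d & d < size s] /\
    standardize [:: nth 0 s a; nth 0 s b; nth 0 s c; nth 0 s d] = p.
Proof.
move=> perm_p sz_p; rewrite contains_occurs //; split.
  move=> [ks [sorted_ks lt_s std]].
  have : size ks = 4 by rewrite -sz_p -std size_standardize size_map.
  case: ks sorted_ks lt_s std => [|a [|b [|c [|d []]]]] //= sorted_ks lt_s std _.
  by exists a, b, c, d; split=> //; lia.
by move=> [a [b [c [d [? std]]]]]; exists [:: a; b; c; d]; split=> //=; lia.
Qed.

Lemma standardize_2413 x y z t :
  standardize [:: x; y; z; t] = [:: 2; 4; 1; 3] <-> [&& z < x, x < t & t < y].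
Proof.
rewrite /standardize /=; split=> [[]|chain]; first by lia.
by congr [:: _; _; _; _]; lia.
Qed.

Lemma standardize_3142 x y z t :
  standardize [:: x; y; z; t] = [:: 3; 1; 4; 2] <-> [&& y < t, t < x & x < z].
Proof.
rewrite /standardize /=; split=> [[]|chain]; first by lia.
by congr [:: _; _; _; _]; lia.
Qed.

Lemma standardize_3124 x y z t :
  standardize [:: x; y; z; t] = [:: 3; 1; 2; 4] <-> [&& y < z, z < x & x < t].
Proof.
rewrite /standardize /=; split=> [[]|chain]; first by lia.
by congr [:: _; _; _; _]; lia.
Qed.

(** * Left-to-right minima and cells *)

Lemma is_lrminP s k :
  reflect (forall j, j < k -> nth 0 s k < nth 0 s j) (is_lrmin s k).
Proof.
apply: (iffP allP) => h j; last by rewrite mem_iota add0n => /h.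
by move=> jk; apply: h; rewrite mem_iota.
Qed.

Definition minpos (s : seq nat) (j : nat) : nat := nth 0 (lrmin_pos s) j.

Definition nonmin (s : seq nat) : pred nat := fun k => (k < size s) && ~~ is_lrmin s k.

Lemma mem_lrmin_pos s k : (k \in lrmin_pos s) = (k < size s) && is_lrmin s k.
Proof. by rewrite mem_filter mem_iota add0n andbC. Qed.

Lemma sorted_lrmin_pos s : sorted ltn (lrmin_pos s).
Proof. exact: sorted_filter ltn_trans _ _ (iota_ltn_sorted _ _). Qed.

Lemma minpos_ltn_size s j : j < size (lrmin_pos s) -> minpos s j < size s.
Proof. by move=> /(mem_nth 0); rewrite mem_lrmin_pos => /andP[]. Qed.

Lemma is_lrmin_minpos s j : j < size (lrmin_pos s) -> is_lrmin s (minpos s j).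
Proof. by move=> /(mem_nth 0); rewrite mem_lrmin_pos => /andP[]. Qed.

Lemma minpos_onto s k : k < size s -> is_lrmin s k ->
  exists2 j, j < size (lrmin_pos s) & minpos s j = k.
Proof.
move=> ks k_min; have k_in : k \in lrmin_pos s by rewrite mem_lrmin_pos ks.
by exists (index k (lrmin_pos s)); rewrite ?index_mem // /minpos nth_index.
Qed.

Lemma ltn_minpos s i j : i < size (lrmin_pos s) -> j < size (lrmin_pos s) ->
  (minpos s i < minpos s j) = (i < j).
Proof. exact: (lt_sorted_ltn_nth 0 (sorted_lrmin_pos s)). Qed.

Lemma ltn_nth_minpos s i j : i < size (lrmin_pos s) -> j < size (lrmin_pos s) ->
  (nth 0 s (minpos s i) < nth 0 s (minpos s j)) = (j < i).
Proof.
move=> i_lt j_lt; have [ji|ij|->] := ltngtP j i; last by rewrite ltnn.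
  by apply: (is_lrminP _ _ (is_lrmin_minpos i_lt)); rewrite ltn_minpos.
apply/negbTE; rewrite -leqNgt ltnW //.
by apply: (is_lrminP _ _ (is_lrmin_minpos j_lt)); rewrite ltn_minpos.
Qed.

Lemma exists_lrmin_below s k :
  exists p, [/\ p <= k, is_lrmin s p & nth 0 s p <= nth 0 s k].
Proof.
elim/ltn_ind: k => k IH.
have [k_min|/allPn[j]] := boolP (is_lrmin s k); first by exists k.
rewrite mem_iota add0n -leqNgt => /= jk s_jk; have [p [pj p_min s_pj]] := IH _ jk.
by exists p; split=> //; [exact: leq_trans pj (ltnW jk) | exact: leq_trans s_pj s_jk].
Qed.

Lemma leq_entry_row s k j : j < size (lrmin_pos s) ->
  (entry_row s k <= j) = (nth 0 s (minpos s j) < nth 0 s k).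
Proof.
move=> j_lt.
have val_j i : i < size (lrmin_pos s) -> nth 0 (lrmin_val s) i = nth 0 s (minpos s i).
  exact: nth_map.
have [row_j|j_row] := leqP (entry_row s k) j; last first.
  by rewrite -val_j ?(before_find 0 j_row).
have row_lt := leq_ltn_trans row_j j_lt.
have has_row : has (fun v => v < nth 0 s k) (lrmin_val s) by rewrite has_find size_map.
have /= := nth_find 0 has_row; rewrite -/(entry_row s k) val_j // => below.
by apply/esym/(leq_ltn_trans _ below); rewrite leqNgt ltn_nth_minpos // -leqNgt.
Qed.

Section Entries.
Variables (s : seq nat) (us : uniq s).

Lemma nonmin_southwest k : nonmin s k -> exists2 j, j < size (lrmin_pos s) &
  minpos s j < k /\ nth 0 s (minpos s j) < nth 0 s k.
Proof.
move=> /andP[ks k_nmin]; have [p [pk p_min s_pk]] := exists_lrmin_below s k.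
have lt_pk : p < k by rewrite ltn_neqAle pk andbT; apply: contraNneq k_nmin => <-.
have [j j_lt p_j] := minpos_onto (ltn_trans lt_pk ks) p_min.
exists j; rewrite ?p_j //; split=> //.
by rewrite ltn_neqAle s_pk andbT nth_uniq ?(ltn_trans lt_pk) // neq_ltn lt_pk.
Qed.

Lemma minpos_neq k j : nonmin s k -> j < size (lrmin_pos s) -> minpos s j != k.
Proof. by move=> /andP[_ k_nmin] /is_lrmin_minpos; apply: contraTneq => ->. Qed.

Lemma ltn_entry_row k j : nonmin s k -> j < size (lrmin_pos s) ->
  (j < entry_row s k) = (nth 0 s k < nth 0 s (minpos s j)).
Proof.
move=> k_nmin j_lt; have [ks _] := andP k_nmin.
rewrite ltnNge leq_entry_row // -leqNgt [LHS]leq_eqVlt nth_uniq ?minpos_ltn_size //.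
by rewrite eq_sym (negbTE (minpos_neq k_nmin j_lt)).
Qed.

Lemma entry_col_spec k : nonmin s k -> entry_col s k < size (lrmin_pos s) /\
  forall j, j < size (lrmin_pos s) -> (j <= entry_col s k) = (minpos s j < k).
Proof.
move=> k_nmin; have [j0 j0_lt [j0k _]] := nonmin_southwest k_nmin.
pose before := [pred j : 'I_(size (lrmin_pos s)) | minpos s j < k].
have [i ik col_i] : {i | i \in before & entry_col s k = i}.
  by apply: eq_bigmax_cond; apply/card_gt0P; exists (Ordinal j0_lt).
split=> [|j j_lt]; first by rewrite col_i.
have [j_col|col_j] := leqP j (entry_col s k).
  rewrite col_i in j_col; apply/esym/(leq_ltn_trans _ ik).
  by rewrite leqNgt ltn_minpos // -leqNgt.
apply/esym; apply: contraTF col_j => jk; rewrite -leqNgt.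
exact: (leq_bigmax_cond (Ordinal j_lt)).
Qed.

Lemma entry_col_ltn k : nonmin s k -> entry_col s k < size (lrmin_pos s).
Proof. by case/entry_col_spec. Qed.

Lemma leq_entry_col k j : nonmin s k -> j < size (lrmin_pos s) ->
  (j <= entry_col s k) = (minpos s j < k).
Proof. by case/entry_col_spec => _; apply. Qed.

Lemma ltn_entry_col k j : nonmin s k -> j < size (lrmin_pos s) ->
  (entry_col s k < j) = (k < minpos s j).
Proof.
move=> k_nmin j_lt; rewrite ltnNge leq_entry_col // -leqNgt leq_eqVlt eq_sym.
by rewrite (negbTE (minpos_neq k_nmin j_lt)).
Qed.

Lemma entry_row_le_col k : nonmin s k -> entry_row s k <= entry_col s k.
Proof.
move=> k_nmin; have [j j_lt []] := nonmin_southwest k_nmin.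
by rewrite -leq_entry_col // -leq_entry_row // => j_col /leq_trans; apply.
Qed.

Lemma entry_row_ltn k : nonmin s k -> entry_row s k < size (lrmin_pos s).
Proof. by move=> k_nmin; apply: leq_ltn_trans (entry_row_le_col _) (entry_col_ltn _). Qed.

Lemma leq_entry_col_mono k l : nonmin s k -> nonmin s l -> k <= l ->
  entry_col s k <= entry_col s l.
Proof.
move=> k_nmin l_nmin kl; have col_lt := entry_col_ltn k_nmin.
by rewrite leq_entry_col //; apply: leq_trans kl; rewrite -leq_entry_col.
Qed.

Lemma geq_entry_row_mono k l : nonmin s k -> nth 0 s k <= nth 0 s l ->
  entry_row s l <= entry_row s k.
Proof.
move=> k_nmin kl; have row_lt := entry_row_ltn k_nmin.
by rewrite leq_entry_row //; apply: leq_trans kl; rewrite -leq_entry_row.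
Qed.

End Entries.

Definition cell_pos (s : seq nat) (i j : nat) : seq nat :=
  [seq k <- iota 0 (size s) |
    [&& ~~ is_lrmin s k, entry_row s k == i & entry_col s k == j]].

Lemma cell_entriesE s i j : cell_entries s i j = [seq nth 0 s k | k <- cell_pos s i j].
Proof. by []. Qed.

Lemma mem_cell_pos s i j k :
  (k \in cell_pos s i j) = [&& nonmin s k, entry_row s k == i & entry_col s k == j].
Proof. by rewrite mem_filter mem_iota add0n /nonmin /= andbC !andbA. Qed.

Lemma sorted_cell_pos s i j : sorted ltn (cell_pos s i j).
Proof. exact: sorted_filter ltn_trans _ _ (iota_ltn_sorted _ _). Qed.

Lemma uniq_cell_entries s i j : uniq s -> uniq (cell_entries s i j).
Proof.
move=> us; rewrite cell_entriesE map_inj_in_uniq ?filter_uniq ?iota_uniq // => k l.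
rewrite !mem_cell_pos => /andP[/andP[ks _] _] /andP[/andP[ls _] _] /eqP.
by rewrite nth_uniq // => /eqP.
Qed.

(** * Staircase words *)

Definition in_row (s : seq nat) (i : nat) : pred nat :=
  fun k => nonmin s k && (entry_row s k == i).

(* The two inequalities say that [k] and [l] lie above and to the right of a common
   left-to-right minimum. *)
Definition single_row_quadrants (s : seq nat) : Prop :=
  forall k l, nonmin s k -> nonmin s l ->
    entry_row s k <= entry_col s l -> entry_row s l <= entry_col s k ->
    entry_row s k = entry_row s l.

Definition increasing_rows (s : seq nat) : Prop :=
  forall k l, nonmin s k -> nonmin s l ->
    entry_row s k = entry_row s l -> entry_col s k < entry_col s l ->
    nth 0 s k < nth 0 s l.

Record staircase (s : seq nat) : Prop := Staircase {
  quadrant_row : single_row_quadrants s;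
  row_increasing : increasing_rows s }.

Definition basis : set (seq nat) :=
  [set [:: 2; 4; 1; 3]; [:: 3; 1; 4; 2]; [:: 3; 1; 2; 4]].

Lemma avoids_2413_increasing_rows s :
  uniq s -> ~ contains s [:: 2; 4; 1; 3] -> increasing_rows s.
Proof.
move=> us avoids k l k_nmin l_nmin row_kl col_kl.
have [[ks _] [ls _]] := (andP k_nmin, andP l_nmin).
have neq_kl : k != l by apply: contraTneq col_kl => ->; rewrite ltnn.
rewrite ltn_neqAle nth_uniq // neq_kl leqNgt; apply/negP => s_lk; apply: avoids.
have row_le := entry_row_le_col us k_nmin; have row_lt := entry_row_ltn us k_nmin.
have col_lt := entry_col_ltn us l_nmin.
apply/contains4P => //.
exists (minpos s (entry_row s k)), k, (minpos s (entry_col s l)), l; split.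
  by rewrite ls -!leq_entry_col // -ltn_entry_col // row_le col_kl leqnn.
apply/standardize_2413; rewrite s_lk ltn_nth_minpos // (leq_ltn_trans row_le) //.
by rewrite -leq_entry_row // row_kl leqnn.
Qed.

Lemma avoids_3142_3124_single_row_quadrants s : uniq s ->
  ~ contains s [:: 3; 1; 4; 2] -> ~ contains s [:: 3; 1; 2; 4] -> single_row_quadrants s.
Proof.
move=> us avoids_3142 avoids_3124.
have not_above k l : nonmin s k -> nonmin s l -> entry_row s l <= entry_col s k ->
    ~~ (entry_row s k < entry_row s l).
  move=> k_nmin l_nmin l_le_k; apply/negP => row_kl.
  have [[ks _] [ls _]] := (andP k_nmin, andP l_nmin).
  have rowk_lt := entry_row_ltn us k_nmin; have rowl_lt := entry_row_ltn us l_nmin.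
  set a := minpos s (entry_row s k); set b := minpos s (entry_row s l).
  have ab : a < b by rewrite ltn_minpos.
  have bk : b < k by rewrite -leq_entry_col.
  have bl : b < l by rewrite -leq_entry_col ?entry_row_le_col.
  have s_bl : nth 0 s b < nth 0 s l by rewrite -leq_entry_row.
  have s_la : nth 0 s l < nth 0 s a by rewrite -ltn_entry_row.
  have s_ak : nth 0 s a < nth 0 s k by rewrite -leq_entry_row.
  have [kl|lk|eq_kl] := ltngtP k l; last by rewrite eq_kl ltnn in row_kl.
    apply/avoids_3142/contains4P => //; exists a, b, k, l.
    by rewrite ab bk kl; split; last by apply/standardize_3142/and3P.
  apply/avoids_3124/contains4P => //; exists a, b, l, k.
  by rewrite ab bl lk; split; last by apply/standardize_3124/and3P.
move=> k l k_nmin l_nmin k_le_l l_le_k; apply/eqP; rewrite eqn_leq leqNgt not_above //=.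
by rewrite leqNgt not_above.
Qed.

Lemma avoids_basis_staircase s :
  uniq s -> (forall p, basis p -> ~ contains s p) -> staircase s.
Proof.
move=> us avoids; split.
  apply: avoids_3142_3124_single_row_quadrants => //; apply: avoids; last by right.
  by left; right.
by apply: avoids_2413_increasing_rows => //; apply: avoids; do 2 left.
Qed.

Definition northeast (s : seq nat) (m k : nat) : bool :=
  [&& m < k, k < size s & nth 0 s m < nth 0 s k].

Lemma northeast_nonmin s m k : northeast s m k -> nonmin s k.
Proof.
move=> /and3P[mk ks s_mk]; rewrite /nonmin ks.
by apply/is_lrminP => /(_ m mk); rewrite ltnNge ltnW.
Qed.

Section StaircaseRows.
Variables (s : seq nat) (us : uniq s) (st : staircase s).

Lemma northeast_row m k l : northeast s m k -> northeast s m l ->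
  entry_row s k = entry_row s l.
Proof.
move=> ne_k ne_l.
have k_nmin := northeast_nonmin ne_k; have l_nmin := northeast_nonmin ne_l.
move: ne_k ne_l => /and3P[mk ks s_mk] /and3P[ml ls s_ml].
have [p [pm p_min s_pm]] := exists_lrmin_below s m.
have [j j_lt p_j] := minpos_onto (leq_ltn_trans pm (ltn_trans mk ks)) p_min.
have row_j x : nth 0 s m < nth 0 s x -> entry_row s x <= j.
  by rewrite leq_entry_row // p_j; apply: leq_ltn_trans.
have j_col x : nonmin s x -> m < x -> j <= entry_col s x.
  by move=> x_nmin; rewrite leq_entry_col // p_j; apply: leq_ltn_trans.
by apply: quadrant_row => //; apply: leq_trans (row_j _ _) (j_col _ _ _).
Qed.

Lemma same_col_row k l : nonmin s k -> nonmin s l -> entry_col s k = entry_col s l ->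
  entry_row s k = entry_row s l.
Proof.
move=> k_nmin l_nmin col_kl; apply: quadrant_row => //.
  by rewrite -col_kl entry_row_le_col.
by rewrite col_kl entry_row_le_col.
Qed.

Lemma row_descent_same_col k l :
  nonmin s k -> nonmin s l -> entry_row s k = entry_row s l -> k < l ->
  nth 0 s l < nth 0 s k -> entry_col s k = entry_col s l.
Proof.
move=> k_nmin l_nmin row_kl kl s_lk.
have := leq_entry_col_mono us k_nmin l_nmin (ltnW kl).
rewrite leq_eqVlt => /predU1P[//|col_kl].
by have := row_increasing st k_nmin l_nmin row_kl col_kl; rewrite ltnNge ltnW.
Qed.

Lemma between_same_row k m l :
  nonmin s k -> nonmin s l -> entry_col s k = entry_col s l -> k < m < l ->
  in_row s (entry_row s k) m.
Proof.
move=> k_nmin l_nmin col_kl /andP[km ml]; have [ls _] := andP l_nmin.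
have ms := ltn_trans ml ls.
have m_nmin : nonmin s m.
  rewrite /nonmin ms; apply/negP => /(minpos_onto ms)[j j_lt m_j]; move: km ml.
  by rewrite -m_j -ltn_entry_col // -leq_entry_col // col_kl; lia.
have col_mk : entry_col s m = entry_col s k.
  have := leq_entry_col_mono us k_nmin m_nmin (ltnW km).
  by have := leq_entry_col_mono us m_nmin l_nmin (ltnW ml); lia.
by rewrite /in_row m_nmin (same_col_row m_nmin k_nmin col_mk) eqxx.
Qed.

(* The minimum below [a] is below [d], so it is below the whole row of [c] and [d]. *)
Lemma value_between_same_cell a c d :
  nonmin s c -> nonmin s d -> entry_row s c = entry_row s d ->
  a < c -> nth 0 s c < nth 0 s a < nth 0 s d ->
  in_row s (entry_row s c) a /\ entry_col s a = entry_col s c.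
Proof.
move=> c_nmin d_nmin row_cd ac /andP[s_ca s_ad]; have [cs _] := andP c_nmin.
have [m [ma m_min s_ma]] := exists_lrmin_below s a.
have [j j_lt m_j] := minpos_onto (leq_ltn_trans ma (ltn_trans ac cs)) m_min.
have s_mc : nth 0 s m < nth 0 s c.
  by rewrite -m_j -leq_entry_row // row_cd leq_entry_row // m_j (leq_ltn_trans s_ma).
have lt_ma : m < a.
  by rewrite ltn_neqAle ma andbT; apply: contraTneq s_ca => <-; rewrite -leqNgt ltnW.
have ne_a : northeast s m a.
  by rewrite /northeast lt_ma (ltn_trans ac) // (ltn_trans s_mc).
have ne_c : northeast s m c by rewrite /northeast (ltn_trans lt_ma) // cs.
have a_nmin := northeast_nonmin ne_a; have row_ac := northeast_row ne_a ne_c.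
by rewrite /in_row a_nmin row_ac eqxx; split=> //; apply: row_descent_same_col.
Qed.

Lemma pattern_2413_row a b c d : [&& a < b, b < c & c < d] ->
  northeast s a b -> northeast s a d ->
  nth 0 s d < nth 0 s b -> nth 0 s c < nth 0 s a ->
  exists i, all (in_row s i) [:: a; b; c; d].
Proof.
move=> /and3P[ab bc cd] ne_ab ne_ad s_db s_ca.
have b_nmin := northeast_nonmin ne_ab; have d_nmin := northeast_nonmin ne_ad.
have row_bd := northeast_row ne_ab ne_ad; have [_ _ s_ad] := and3P ne_ad.
have col_bd : entry_col s b = entry_col s d.
  by apply: row_descent_same_col => //; apply: ltn_trans cd.
have /andP[c_nmin /eqP row_cb] : in_row s (entry_row s b) c.
  by apply: between_same_row col_bd _; rewrite ?bc.
have [||a_row _] := value_between_same_cell c_nmin d_nmin (etrans row_cb row_bd) (a := a).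
- exact: ltn_trans bc.
- by rewrite s_ca.
exists (entry_row s c).
by rewrite /= a_row /in_row b_nmin c_nmin d_nmin -row_bd row_cb !eqxx.
Qed.

(* Covers 3142 with [(x, y) = (d, c)] and 3124 with [(x, y) = (c, d)]. *)
Lemma pattern_31_row a b x y : a < b -> northeast s b x -> northeast s b y ->
  nth 0 s x < nth 0 s a < nth 0 s y -> exists i, all (in_row s i) [:: a; b; x; y].
Proof.
move=> ab ne_bx ne_by s_xay; have [bx _ _] := and3P ne_bx.
have x_nmin := northeast_nonmin ne_bx; have y_nmin := northeast_nonmin ne_by.
have row_xy := northeast_row ne_bx ne_by.
have [/andP[a_nmin /eqP row_ax] col_ax] :=
  value_between_same_cell x_nmin y_nmin row_xy (ltn_trans ab bx) s_xay.
have b_row : in_row s (entry_row s a) b by apply: between_same_row col_ax _; rewrite ?ab.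
exists (entry_row s a).
by rewrite /= b_row /in_row a_nmin x_nmin y_nmin -row_xy row_ax !eqxx.
Qed.

Lemma occurs_in_row_contains i p :
  is_perm p -> occurs_in s (in_row s i) p -> contains s p.
Proof.
move=> perm_p [ks [sorted_ks in_i std]]; apply/contains_occurs => //.
exists ks; split=> //.
by apply: sub_all in_i => k /andP[/andP[]].
Qed.

Lemma contains_basis_occurs_in_row p : basis p -> contains s p ->
  exists i, occurs_in s (in_row s i) p.
Proof.
move=> basis_p; have [perm_p sz_p] : is_perm p /\ size p = 4 by case: basis_p => [[]|] ->.
case/contains4P => // a [b [c [d [lt_pos std]]]].
have [i in_i] : exists i, all (in_row s i) [:: a; b; c; d]; last first.
  by exists i, [:: a; b; c; d]; split=> //=; lia.
have ne k l : k < l < size s -> nth 0 s k < nth 0 s l -> northeast s k l.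
  by rewrite /northeast => /andP[-> ->].
case: basis_p std => [[->|->]|->].
- by move=> /standardize_2413 lt_val; apply: pattern_2413_row; rewrite ?ne //; lia.
- move=> /standardize_3142 lt_val.
  have [||||i] := @pattern_31_row a b d c; rewrite ?ne //; try lia.
  by case/and5P=> a_i b_i d_i c_i _; exists i; rewrite /= a_i b_i c_i d_i.
- by move=> /standardize_3124 lt_val; apply: pattern_31_row; rewrite ?ne //; lia.
Qed.

Lemma contains_oplus1_occurs_in_row p :
  is_perm p -> p <> [::] -> contains s (oplus [:: 1] p) ->
  exists i, occurs_in s (in_row s i) p.
Proof.
move=> perm_p p_neq0 /contains_occurs[]; first exact: is_perm_oplus.
move=> [|m ks] [sorted_ks lt_s /standardize_eq_oplus[]//= _ std sep].
rewrite drop0 in std sep.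
have ne_m k : k \in ks -> northeast s m k.
  move=> k_ks; apply/and3P; split.
  - exact: (allP (order_path_min ltn_trans sorted_ks)).
  - by apply: (allP lt_s); rewrite inE k_ks orbT.
  - by apply: sep; rewrite ?mem_head ?map_f.
case: ks => [|k ks] in sorted_ks lt_s std sep ne_m *; first by case: p_neq0.
exists (entry_row s k), (k :: ks); split=> //; first exact: path_sorted sorted_ks.
apply/allP => l l_ks; rewrite /in_row (northeast_nonmin (ne_m l l_ks)).
by rewrite (northeast_row (ne_m l l_ks) (ne_m k (mem_head _ _))) /=.
Qed.

Lemma occurs_in_row_contains_oplus1 i p : is_perm p -> p <> [::] ->
  occurs_in s (in_row s i) p -> contains s (oplus [:: 1] p).
Proof.
move=> perm_p p_neq0 [ks [sorted_ks /allP in_i std]].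
have [k k_ks] : exists k, k \in ks.
  by case: ks std p_neq0 {sorted_ks in_i} => [<-//|k ks]; exists k; rewrite mem_head.
have i_lt : i < size (lrmin_pos s).
  by have /andP[k_nmin /eqP<-] := in_i k k_ks; apply: entry_row_ltn.
have ne_i l : l \in ks -> northeast s (minpos s i) l.
  move=> /in_i/andP[l_nmin /eqP row_l]; have [ls _] := andP l_nmin.
  rewrite /northeast ls -leq_entry_col // -leq_entry_row //.
  by rewrite -row_l leqnn entry_row_le_col.
apply/contains_occurs; first exact: is_perm_oplus.
exists (minpos s i :: ks); split=> /=.
- by rewrite path_min_sorted //; apply/allP => l /ne_i/and3P[].
- by rewrite minpos_ltn_size //; apply/allP => l /ne_i/and3P[].
- rewrite -cat1s standardize_cat ?standardize1 ?std // => x y.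
  by rewrite inE => /eqP-> /mapP[l /ne_i/and3P[_ _ s_il] ->].
Qed.

(* A later column of the row holds larger values, so it would be a proper summand. *)
Lemma indecomposable_same_col i ks : sorted ltn ks -> all (in_row s i) ks ->
  sum_indecomposable (standardize [seq nth 0 s k | k <- ks]) ->
  {in ks &, forall k l, entry_col s k = entry_col s l}.
Proof.
move=> sorted_ks /allP in_i indec.
suff col_le k l : k \in ks -> l \in ks -> entry_col s l <= entry_col s k.
  by move=> k l k_ks l_ks; apply/eqP; rewrite eqn_leq !col_le.
move=> k_ks l_ks; pose left := [pred m | entry_col s m <= entry_col s k].
have nmin m : m \in ks -> nonmin s m by case/in_i/andP.
have row_i m : m \in ks -> entry_row s m = i by case/in_i/andP=> _ /eqP.
have split_ks : ks = [seq m <- ks | left m] ++ [seq m <- ks | ~~ left m].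
  apply: (sorted_filterID ltn_trans) => // m m' m_ks m'_ks mm'; apply: leq_trans.
  by apply: leq_entry_col_mono; rewrite ?nmin // ltnW.
have u_ks : uniq [seq nth 0 s m | m <- ks].
  rewrite map_inj_in_uniq ?(sorted_uniq ltn_trans ltnn) // => m m' m_ks m'_ks /eqP.
  by rewrite nth_uniq // ?(andP (nmin _ _)).1 // => /eqP.
rewrite split_ks map_cat in indec u_ks.
have [|left0|right0] := sum_indecomposable_cat u_ks _ indec.
- move=> _ _ /mapP[m + ->] /mapP[m' + ->].
  rewrite !mem_filter -ltnNge => /andP[left_m m_ks] /andP[left_m' m'_ks].
  by apply: row_increasing; rewrite ?nmin ?row_i // (leq_ltn_trans left_m).
- have : nth 0 s k \in [seq nth 0 s m | m <- ks & left m].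
    by rewrite map_f ?mem_filter /= ?leqnn.
  by rewrite left0.
- apply: contraT => not_left.
  have : nth 0 s l \in [seq nth 0 s m | m <- ks & ~~ left m].
    by rewrite map_f ?mem_filter /= ?not_left.
  by rewrite right0.
Qed.

End StaircaseRows.

(** * The staircase encoding of a word *)

Lemma cell_eq n (c d : cell n) :
  crow c = crow d :> nat -> ccol c = ccol d :> nat -> c = d.
Proof.
move=> eq_row eq_col; apply: val_inj; rewrite [val c]surjective_pairing.
by rewrite [RHS]surjective_pairing; congr (_, _); apply: val_inj.
Qed.

Lemma crow_le_ccol n (c : cell n) : crow c <= ccol c.
Proof. exact: valP c. Qed.

Lemma cell_exists n i j : i <= j < n ->
  exists c : cell n, crow c = i :> nat /\ ccol c = j :> nat.
Proof.
move=> /andP[ij jn]; have c_in : inB (Ordinal (leq_ltn_trans ij jn), Ordinal jn) by [].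
by exists (Sub _ c_in).
Qed.

Lemma rect_inBE n (i k j l : 'I_n) : i <= k -> j <= l -> rect_inB i k j l = (k <= j).
Proof.
move=> ik jl; apply/idP/idP => [/forallP/(_ k)/forallP/(_ j)|kj].
  by rewrite ik jl !leqnn.
apply/forallP => a; apply/forallP => b; apply/implyP => /andP[/andP[_ ak] /andP[jb _]].
exact: leq_trans ak (leq_trans kj jb).
Qed.

Lemma UDCE n (c d : cell n) :
  UDC c d = [&& crow c != crow d, crow c <= ccol d & crow d <= ccol c].
Proof.
have down_adjE (a b : cell n) :
    down_adj a b = [&& crow a < crow b, ccol a < ccol b & crow b <= ccol a].
  rewrite /down_adj; case: ltnP => //= row_ab; case: ltnP => //= col_ab.
  by rewrite rect_inBE // ltnW.
rewrite /UDC !down_adjE /up_adj; have [->|neq_cd] := eqVneq c d; first by rewrite !eqxx.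
have neq_row_col : ~ (crow c = crow d :> nat /\ ccol c = ccol d :> nat).
  by case=> row_cd col_cd; rewrite (cell_eq row_cd col_cd) eqxx in neq_cd.
by have := crow_le_ccol c; have := crow_le_ccol d; rewrite -!val_eqE /=; lia.
Qed.

Section Encoding.
Variables (n : nat) (s : seq nat).
Hypotheses (us : uniq s) (sn : size (lrmin_pos s) = n).

Local Notation cell_label c := (rho c (nonempty_cells (SE n s))).

Lemma nonmin_cell k : nonmin s k -> exists c : cell n, k \in cell_pos s (crow c) (ccol c).
Proof.
move=> k_nmin; have [|c [row_c col_c]] := @cell_exists n (entry_row s k) (entry_col s k).
  by rewrite -sn entry_row_le_col ?entry_col_ltn.
by exists c; rewrite mem_cell_pos k_nmin row_c col_c !eqxx.
Qed.

Lemma is_perm_SE (c : cell n) : is_perm (SE n s c).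
Proof. by rewrite ffunE is_perm_standardize ?uniq_cell_entries. Qed.

Lemma contains_SE (c : cell n) p : is_perm p ->
  contains (SE n s c) p <-> occurs_in s [in cell_pos s (crow c) (ccol c)] p.
Proof.
by move=> perm_p; rewrite ffunE contains_standardize contains_nths ?sorted_cell_pos.
Qed.

Lemma nonempty_SEP (c : cell n) :
  reflect (exists k, k \in cell_pos s (crow c) (ccol c)) (c \in nonempty_cells (SE n s)).
Proof.
rewrite inE ffunE -size_eq0 size_standardize cell_entriesE size_map size_eq0.
apply: (iffP idP) => [|[k]]; last by case: (cell_pos _ _ _).
by case: (cell_pos _ _ _) => // k t _; exists k; rewrite mem_head.
Qed.

Lemma independent_SE :
  independent (@UDC n) (nonempty_cells (SE n s)) <-> single_row_quadrants s.
Proof.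
split=> [indep k l k_nmin l_nmin|quadrant c d].
  have [c k_c] := nonmin_cell k_nmin; have [d l_d] := nonmin_cell l_nmin.
  have c_ne : c \in nonempty_cells (SE n s) by apply/nonempty_SEP; exists k.
  have d_ne : d \in nonempty_cells (SE n s) by apply/nonempty_SEP; exists l.
  move: k_c l_d (indep c d c_ne d_ne); rewrite !mem_cell_pos UDCE.
  move=> /and3P[_ /eqP-> /eqP->] /and3P[_ /eqP-> /eqP->] + row_c row_d.
  by rewrite row_c row_d !andbT negbK => /eqP->.
move=> /nonempty_SEP[k k_c] /nonempty_SEP[l l_d]; move: k_c l_d.
rewrite !mem_cell_pos UDCE -val_eqE /=.
move=> /and3P[k_nmin /eqP<- /eqP<-] /and3P[l_nmin /eqP<- /eqP<-].
by apply/and3P => -[/eqP neq_row row_k row_l]; apply/neq_row/quadrant.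
Qed.

Lemma rho_SEP (c : cell n) :
  match cell_label c with
  | LabelY => exists2 l, in_row s (crow c) l & ccol c < entry_col s l
  | LabelZ => forall l, in_row s (crow c) l -> entry_col s l <= ccol c
  end.
Proof.
rewrite /rho; case: ifPn => [/exists_inP[d /nonempty_SEP[l]]|none l].
  rewrite mem_cell_pos => /and3P[l_nmin row_l /eqP col_l] /andP[/eqP row_d col_d].
  by exists l; rewrite ?col_l // /in_row l_nmin -row_d.
move=> /andP[l_nmin /eqP row_l]; rewrite leqNgt; apply: contra none => col_l.
have [d l_d] := nonmin_cell l_nmin.
apply/exists_inP; exists d; first by apply/nonempty_SEP; exists l.
move: l_d; rewrite mem_cell_pos row_l -val_eqE /=.
by move=> /and3P[_ /eqP-> /eqP<-]; rewrite eqxx.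
Qed.

Definition cell_pattern (r : label) (p : seq nat) : seq nat :=
  if r is LabelY then bar p else p.

Section Staircase.
Hypothesis st : staircase s.

Lemma contains_SE_occurs_in_row (c : cell n) p : is_perm p ->
  contains (SE n s c) (cell_pattern (cell_label c) p) ->
  occurs_in s (in_row s (crow c)) p.
Proof.
move=> perm_p; have perm_bar := is_perm_bar perm_p.
have in_row_c k : k \in cell_pos s (crow c) (ccol c) -> in_row s (crow c) k.
  by rewrite mem_cell_pos => /and3P[k_nmin row_k _]; rewrite /in_row k_nmin.
have cell_row q : is_perm q -> contains (SE n s c) q -> occurs_in s (in_row s (crow c)) q.
  move=> perm_q /contains_SE[]// ks [sorted_ks in_c std]; exists ks; split=> //.
  exact: sub_all in_c.
have := rho_SEP c; case: rho => /= [[l l_row col_l]|_]; last exact: cell_row.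
have [->|[_ p_eq]] := barP p; first exact: cell_row.
move=> /contains_SE[]// ks [sorted_ks /allP in_c std].
have [l_nmin /eqP row_l] := andP l_row.
have before_l k : k \in ks -> k < l /\ nth 0 s k < nth 0 s l.
  move=> /in_c /=; rewrite mem_cell_pos => /and3P[k_nmin /eqP row_k /eqP col_k].
  split; last by apply: (row_increasing st); rewrite ?row_k ?col_k.
  rewrite ltnNge; apply/negP => /(leq_entry_col_mono us l_nmin k_nmin).
  by rewrite col_k leqNgt col_l.
exists (rcons ks l); split.
- rewrite (sorted_pairwise ltn_trans) pairwise_rcons -(sorted_pairwise ltn_trans).
  rewrite sorted_ks andbT.
  by apply/allP => k /before_l[].
- by rewrite all_rcons l_row; apply/allP => k /in_c/in_row_c.
- rewrite p_eq map_rcons -cats1 standardize_cat ?std ?standardize1 // => x y.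
  by move=> /mapP[k /before_l[_ s_kl] ->]; rewrite inE => /eqP->.
Qed.

Lemma occurs_in_row_contains_SE i p : p <> [::] -> is_perm p ->
  sum_indecomposable (bar p) -> occurs_in s (in_row s i) p ->
  exists c : cell n, [/\ c \in nonempty_cells (SE n s), crow c = i :> nat &
    contains (SE n s c) (cell_pattern (cell_label c) p)].
Proof.
move=> p_neq0 perm_p indec [[|k0 ks] [sorted_ks /allP in_i std]]; first by case: p_neq0.
have [k0_nmin /eqP row_k0] := andP (in_i k0 (mem_head _ _)).
have [c k0_c] := nonmin_cell k0_nmin; exists c.
have [/eqP row_c /eqP col_c] : crow c == i :> nat /\ ccol c == entry_col s k0 :> nat.
  by move: k0_c; rewrite mem_cell_pos row_k0 => /and3P[_ /eqP-> /eqP->].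
split=> //; first by apply/nonempty_SEP; exists k0.
have in_c k : k \in k0 :: ks -> entry_col s k = entry_col s k0 ->
    k \in cell_pos s (crow c) (ccol c).
  move=> /in_i/andP[k_nmin row_k] col_k.
  by rewrite mem_cell_pos k_nmin row_c col_c row_k col_k /=.
have := rho_SEP c; case: rho => /= [_|last_c]; apply/contains_SE => //.
- exact: is_perm_bar.
- set js := take (size (bar p)) (k0 :: ks).
  have std_js : standardize [seq nth 0 s k | k <- js] = bar p.
    by rewrite map_take -std standardize_take_bar.
  exists js; split=> //; first exact: take_sorted.
  have js_i : all (in_row s i) js by apply/allP => k /mem_take/in_i.
  apply/allP => k k_js; apply: in_c; first exact: mem_take k_js.
  apply: indecomposable_same_col js_i _ _ _ _ _ => //; rewrite ?std_js //.
  + exact: take_sorted.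
  + by move: k_js; rewrite /js; case: size => // m _; rewrite mem_head.
- exists (k0 :: ks); split=> //; apply/allP => k k_ks; apply: in_c => //.
  have [k_nmin _] := andP (in_i k k_ks).
  apply/eqP; rewrite eqn_leq -col_c last_c ?row_c ?in_i //= col_c leq_entry_col_mono //.
  move: k_ks; rewrite inE => /predU1P[->//|k_ks].
  by rewrite ltnW // (allP (order_path_min ltn_trans sorted_ks)).
Qed.

Lemma WI_SE_rows (B : set (seq nat)) :
  (forall p, B p -> is_perm p /\ p <> [::]) ->
  (forall p, B p -> sum_indecomposable (bar p)) ->
  WI (@rho n) (@UDC n) (Avp (bar @` B)) (Avp B) (SE n s) <->
  forall p, B p -> forall i, ~ occurs_in s (in_row s i) p.
Proof.
move=> B_perm B_indec; split=> [[_ cells] p Bp i occ|avoids].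
  have [perm_p p_neq0] := B_perm p Bp.
  have [c [c_ne _ occ_c]] := occurs_in_row_contains_SE p_neq0 perm_p (B_indec p Bp) occ.
  move: (cells c c_ne) occ_c; case: rho => -[[_ av] _]; apply: av => //.
  by exists p.
split; first exact/independent_SE/quadrant_row.
move=> c c_ne; have w_neq0 : SE n s c <> [::] by apply/eqP; move: c_ne; rewrite inE.
have avoids_c p : B p -> ~ contains (SE n s c) (cell_pattern (cell_label c) p).
  move=> Bp occ; apply: (avoids p Bp (crow c)).
  by apply: contains_SE_occurs_in_row occ; case: (B_perm p Bp).
case: rho avoids_c => avoids_c; split=> //; split; rewrite ?is_perm_SE //.
by move=> _ [p Bp <-]; apply: avoids_c.
Qed.

End Staircase.
End Encoding.

(** * Permutations as pairs of linear orders *)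

Lemma lt_mono_of_homo d d' (T : eqType) (O : orderType d) (O' : orderType d') (D : seq T)
    (key : T -> O) (f : T -> O') :
  {in D &, injective key} -> {in D &, forall x y, (key x < key y)%O -> (f x < f y)%O} ->
  {in D &, forall x y, (f x < f y)%O = (key x < key y)%O}.
Proof.
move=> key_inj homo x y xD yD; have [lt_xy|lt_yx|eq_xy] := ltgtP (key x) (key y).
- exact: homo.
- by apply/negbTE; rewrite -leNgt ltW // homo.
- by rewrite (key_inj x y) // ltxx.
Qed.

Section TwoOrders.
Variables (d d' : Order.disp_t) (T : eqType) (O : orderType d) (O' : orderType d').
Variables (D : seq T) (kpos : T -> O) (kval : T -> O').

Record realizes (s : seq nat) (pos : T -> nat) : Prop := Realizes {
  realizes_perm : is_perm s;
  pos_ltn_size : {in D, forall x, pos x < size s};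
  pos_onto : forall k, k < size s -> exists2 x, x \in D & pos x = k;
  ltn_pos : {in D &, forall x y, (pos x < pos y) = (kpos x < kpos y)%O};
  ltn_nth_pos : {in D &, forall x y,
    (nth 0 s (pos x) < nth 0 s (pos y)) = (kval x < kval y)%O} }.

Lemma realizes_pos_le s pos s' pos' : realizes s pos -> realizes s' pos' ->
  {in D, forall x, pos x <= pos' x}.
Proof.
move=> R R'; suff le_pos k x : x \in D -> pos x = k -> k <= pos' x.
  by move=> x xD; apply: le_pos.
elim: k x => // k IH x xD pos_x.
have k_lt : k < size s by rewrite ltnW // -pos_x pos_ltn_size.
have [y yD pos_y] := pos_onto R k_lt.
apply: (@leq_ltn_trans (pos' y)); first exact: IH.
by rewrite (ltn_pos R') // -(ltn_pos R) // pos_x pos_y.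
Qed.

Lemma realizes_unique s pos s' pos' : realizes s pos -> realizes s' pos' -> s = s'.
Proof.
move=> R R'.
have eq_pos : {in D, pos =1 pos'}.
  move=> x xD; apply/eqP.
  by rewrite eqn_leq (realizes_pos_le R R') // (realizes_pos_le R' R).
have size_le r q r' q' :
    realizes r q -> realizes r' q' -> {in D, q =1 q'} -> size r <= size r'.
  move=> Rr Rr' eq_q; case sz_r : (size r) => [//|k].
  have [x xD <-] : exists2 x, x \in D & q x = k by apply: (pos_onto Rr); rewrite sz_r.
  by rewrite eq_q // (pos_ltn_size Rr').
have eq_sz : size s = size s'.
  apply/eqP; rewrite eqn_leq (size_le _ _ _ _ R R') //= (size_le _ _ _ _ R' R) //.
  by move=> x /eq_pos.
rewrite -(standardize_id (realizes_perm R)) -(standardize_id (realizes_perm R')).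
apply/order_isoE; split=> // i j /(pos_onto R)[x xD <-] /(pos_onto R)[y yD <-].
by rewrite (ltn_nth_pos R) // !eq_pos // (ltn_nth_pos R').
Qed.

Hypotheses (kpos_inj : {in D &, injective kpos}) (kval_inj : {in D &, injective kval}).

Lemma realizes_exists : exists s pos, realizes s pos.
Proof.
pose e := sort (relpre kpos <=%O) (undup D); pose V := [seq kval x | x <- D].
have mem_e x : (x \in e) = (x \in D) by rewrite mem_sort mem_undup.
have sorted_e : sorted (relpre kpos <%O) e.
  rewrite -sorted_map -sort_map sort_lt_sorted map_inj_in_uniq ?undup_uniq // => x y.
  by rewrite !mem_undup; apply: kpos_inj.
have kpos_trans : transitive (relpre kpos <%O) by move=> y x z; apply: lt_trans.
have uniq_e : uniq e by rewrite sort_uniq undup_uniq.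
exists (standardize [seq rank V (kval x) | x <- e]), (index^~ e).
have sz : size (standardize [seq rank V (kval x) | x <- e]) = size e.
  by rewrite size_standardize size_map.
split=> [|x|k|x y|x y]; rewrite ?sz.
- apply: is_perm_standardize; rewrite map_inj_in_uniq // => x y; rewrite !mem_e => xD yD.
  by move/rank_inj => /(_ (map_f kval xD) (map_f kval yD)); apply: kval_inj.
- by rewrite index_mem mem_e.
- case def_e: e => [//|x0 e']; rewrite -def_e => ke.
  by exists (nth x0 e k); rewrite -?mem_e ?mem_nth ?index_uniq.
- rewrite -!mem_e => xe ye.
  have index_inj : {in e &, injective (index^~ e)}.
    by move=> a b ae be /= eq_idx; rewrite -(nth_index a ae) eq_idx nth_index.
  by rewrite (lt_mono_of_homo index_inj (sorted_ltn_index kpos_trans sorted_e)).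
- rewrite -!mem_e => xe ye; rewrite ltn_nth_standardize ?size_map ?index_mem //.
  by rewrite !(nth_map x) ?index_mem // !nth_index // ltn_rank // map_f -?mem_e.
Qed.

End TwoOrders.

(** * Reading a permutation off a filling *)

Section Labels.
Variables (n : nat).
Implicit Types (w : filling n) (x y : cell n * nat).

Definition diag (j : 'I_n) : cell n := Sub (j, j) (leqnn j).

(* The label [(c, t.+1)] is the [t]-th entry of the cell [c], counted from 0, and
   [(c, 0)], for [c] on the diagonal, is the left-to-right minimum of its row. *)
Definition labels w : seq (cell n * nat) :=
  [seq x <- [seq (c, t) | c <- enum {: cell n}, t <- iota 0 (size (w c)).+1]
         | (x.2 == 0) ==> (crow x.1 == ccol x.1)].

Definition poskey x : (nat *l nat)%type := (ccol x.1 : nat, x.2).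

(* Rows are numbered from the top; the entry 0 puts a minimum below its row. *)
Definition valkey w x : (nat *l (nat *l nat))%type :=
  (n - crow x.1, (ccol x.1 : nat, nth 0 (0 :: w x.1) x.2)).

Lemma mem_labels w x :
  (x \in labels w) = (x.2 <= size (w x.1)) && ((x.2 == 0) ==> (crow x.1 == ccol x.1)).
Proof.
rewrite mem_filter andbC; congr (_ && _).
apply/allpairsPdep/idP => [[c [t [_ + ->]]]|x_le]; first by rewrite mem_iota.
by exists x.1, x.2; rewrite mem_enum mem_iota -surjective_pairing.
Qed.

Lemma diag_labels w j : (diag j, 0) \in labels w.
Proof. by rewrite mem_labels /= eqxx. Qed.

Lemma poskey_lt x y :
  (poskey x < poskey y)%O =
    (ccol x.1 < ccol y.1) || (ccol x.1 == ccol y.1) && (x.2 < y.2).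
Proof. by rewrite ltEprodlexi -val_eqE !leEnat ltEnat /=; lia. Qed.

Lemma valkey_lt w x y : (valkey w x < valkey w y)%O =
  (crow y.1 < crow x.1) || (crow x.1 == crow y.1) &&
    ((ccol x.1 < ccol y.1) || (ccol x.1 == ccol y.1) &&
      (nth 0 (0 :: w x.1) x.2 < nth 0 (0 :: w y.1) y.2)).
Proof.
have := ltn_ord (crow x.1); have := ltn_ord (crow y.1).
by rewrite !ltEprodlexi -!val_eqE !leEnat !ltEnat /=; lia.
Qed.

Lemma poskey_inj w : independent (@UDC n) (nonempty_cells w) ->
  {in labels w &, injective poskey}.
Proof.
move=> indep [c t] [d u]; rewrite !mem_labels /= => /andP[t_le t_diag] /andP[u_le u_diag].
case=> col_cd eq_tu; rewrite -eq_tu in u_le u_diag *; congr (_, _).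
suff row_cd : crow c = crow d :> nat by apply: cell_eq.
have [t0|t_gt0] := eqVneq t 0.
  by rewrite t0 /= in t_diag u_diag; rewrite (eqP t_diag) (eqP u_diag).
have ne c' : t <= size (w c') -> c' \in nonempty_cells w.
  by move=> t_le'; rewrite inE -size_eq0 -lt0n (leq_trans _ t_le') // lt0n.
have := indep c d (ne c t_le) (ne d u_le).
by rewrite UDCE col_cd (crow_le_ccol d) -col_cd crow_le_ccol !andbT negbK => /eqP->.
Qed.

Lemma valkey_inj w : (forall c, is_perm (w c)) -> {in labels w &, injective (valkey w)}.
Proof.
move=> w_perm [c t] [d u]; rewrite !mem_labels /= => /andP[t_le _] /andP[u_le _].
case=> row_cd col_cd; have eq_cd : c = d.
  by apply: cell_eq => //; have := ltn_ord (crow c); have := ltn_ord (crow d); lia.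
have u_0w : uniq (0 :: w c) by rewrite /= mem_is_perm ?is_perm_uniq.
by move: u_le; rewrite -eq_cd => u_le /eqP; rewrite nth_uniq // => /eqP->.
Qed.

Lemma poskey_diag_lt (j : 'I_n) x : 0 < x.2 ->
  (poskey (diag j, 0) < poskey x)%O = (j <= ccol x.1).
Proof. by move=> x_gt0; rewrite poskey_lt x_gt0 andbT orbC -leq_eqVlt. Qed.

Lemma valkey_diag_lt w (j : 'I_n) x :
  (forall c, is_perm (w c)) -> x \in labels w -> 0 < x.2 ->
  (valkey w (diag j, 0) < valkey w x)%O = (crow x.1 <= j).
Proof.
case: x => c [//|t] w_perm; rewrite mem_labels => /andP[t_le _] _.
have val_gt0 : 0 < nth 0 (w c) t.
  by have := mem_nth 0 t_le; rewrite mem_is_perm // => /andP[].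
have row_diag : crow (diag j) = j by []; have col_diag : ccol (diag j) = j by [].
have := crow_le_ccol c; rewrite valkey_lt row_diag col_diag -!val_eqE /= val_gt0; lia.
Qed.

End Labels.

Section Encode.
Variables (n : nat) (s : seq nat).
Hypotheses (perm_s : is_perm s) (sn : size (lrmin_pos s) = n) (st : staircase s).

Let us : uniq s := is_perm_uniq perm_s.
Local Notation w := (SE n s).

Definition label_pos (x : cell n * nat) : nat :=
  nth 0 (minpos s (crow x.1) :: cell_pos s (crow x.1) (ccol x.1)) x.2.

Lemma size_SE c : size (w c) = size (cell_pos s (crow c) (ccol c)).
Proof. by rewrite ffunE size_standardize cell_entriesE size_map. Qed.

Lemma label_posP (x : cell n * nat) : x \in labels w ->
  [/\ x.2 = 0, crow x.1 = ccol x.1 :> nat & label_pos x = minpos s (crow x.1)] \/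
  [/\ 0 < x.2, nonmin s (label_pos x), entry_row s (label_pos x) = crow x.1 &
      entry_col s (label_pos x) = ccol x.1].
Proof.
case: x => c [|t]; rewrite mem_labels ?size_SE /=.
  by move=> /eqP diag_c; left; split; rewrite // diag_c.
move=> /andP[/(mem_nth 0) + _]; rewrite mem_cell_pos.
by move=> /and3P[k_nmin /eqP row_k /eqP col_k]; right.
Qed.

Lemma label_pos_homo (x y : cell n * nat) : x \in labels w -> y \in labels w ->
  (poskey x < poskey y)%O -> label_pos x < label_pos y.
Proof.
have crow_lt (c : cell n) : crow c < size (lrmin_pos s) by rewrite sn.
move=> xL yL; rewrite poskey_lt -val_eqE /= => lt_xy.
have [[x0 diag_x ->]|[x_gt0 x_nmin row_x col_x]] := label_posP xL;
have [[y0 diag_y ->]|[y_gt0 y_nmin row_y col_y]] := label_posP yL.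
- by rewrite ltn_minpos //; lia.
- by rewrite -leq_entry_col // col_y; lia.
- by rewrite -ltn_entry_col // col_x; lia.
case/orP: lt_xy => [lt_col|/andP[/eqP eq_col lt_idx]].
  rewrite ltnNge; apply/negP => /(leq_entry_col_mono us y_nmin x_nmin).
  by rewrite col_x col_y leqNgt lt_col.
have eq_cell : x.1 = y.1.
  apply: cell_eq => //; rewrite -row_x -row_y.
  by apply: same_col_row; rewrite ?col_x ?col_y.
move: xL yL x_gt0 lt_idx; rewrite !mem_labels !size_SE /label_pos eq_cell.
case: x.2 y.2 => [|t] [|u] //= /andP[t_le _] /andP[u_le _] _ lt_tu.
exact: (sorted_ltn_nth ltn_trans 0 (sorted_cell_pos _ _ _)).
Qed.

Lemma label_val_homo (x y : cell n * nat) : x \in labels w -> y \in labels w ->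
  (valkey w x < valkey w y)%O -> nth 0 s (label_pos x) < nth 0 s (label_pos y).
Proof.
have crow_lt (c : cell n) : crow c < size (lrmin_pos s) by rewrite sn.
move=> xL yL; rewrite valkey_lt -!val_eqE /= => lt_xy.
have := crow_le_ccol x.1; have := crow_le_ccol y.1; move: lt_xy.
have [[x0 diag_x ->]|[x_gt0 x_nmin row_x col_x]] := label_posP xL;
have [[y0 diag_y ->]|[y_gt0 y_nmin row_y col_y]] := label_posP yL.
- by rewrite ltn_nth_minpos // x0 y0 /=; lia.
- by rewrite -leq_entry_row // row_y; lia.
- by rewrite -ltn_entry_row // row_x y0 /= ltn0; lia.
move=> + _ _; case/orP=> [lt_row|/andP[/eqP eq_row]].
  rewrite ltnNge; apply/negP => /(geq_entry_row_mono us y_nmin).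
  by rewrite row_x row_y leqNgt lt_row.
case/orP=> [lt_col|/andP[/eqP eq_col lt_val]].
  by apply: (row_increasing st); rewrite ?row_x ?row_y ?col_x ?col_y.
have eq_cell : x.1 = y.1 by apply: cell_eq.
move: xL yL x_gt0 y_gt0 lt_val.
rewrite !mem_labels /label_pos eq_cell !size_SE ffunE cell_entriesE.
case: x.2 y.2 => [|t] [|u] //= /andP[t_le _] /andP[u_le _] _ _.
by rewrite ltn_nth_standardize ?size_map // !(nth_map 0).
Qed.

Lemma realizes_SE : realizes (labels w) (@poskey n) (valkey w) s label_pos.
Proof.
have indep : independent (@UDC n) (nonempty_cells w) by apply/independent_SE/quadrant_row.
split=> //.
- move=> x /label_posP[[_ _ ->]|[_ /andP[]]] //.
  by apply: minpos_ltn_size; rewrite sn.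
- move=> k ks; have [k_min|k_nmin] := boolP (is_lrmin s k).
    have [j] := minpos_onto ks k_min; rewrite sn => j_lt pos_j.
    by exists (diag (Ordinal j_lt), 0); rewrite ?diag_labels.
  have [|c k_c] := @nonmin_cell n s us sn k; first by rewrite /nonmin ks.
  exists (c, (index k (cell_pos s (crow c) (ccol c))).+1); last exact: nth_index.
  by rewrite mem_labels /= size_SE index_mem k_c.
- exact: (lt_mono_of_homo (O' := nat) (poskey_inj indep) label_pos_homo).
- exact: (lt_mono_of_homo (O' := nat) (valkey_inj (is_perm_SE us)) label_val_homo).
Qed.

End Encode.

Section Decode.
Variables (n : nat) (w : filling n) (s : seq nat) (pos : cell n * nat -> nat).
Hypothesis w_perm : forall c, is_perm (w c).
Hypothesis R : realizes (labels w) (@poskey n) (valkey w) s pos.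

Let us : uniq s := is_perm_uniq (realizes_perm R).

Lemma label_onto k : k < size s -> exists2 x : cell n * nat, x \in labels w & pos x = k.
Proof. exact: (pos_onto R). Qed.

Lemma is_lrmin_pos (x : cell n * nat) : x \in labels w -> is_lrmin s (pos x) = (x.2 == 0).
Proof.
move=> xL; apply/is_lrminP/idP => [x_min|/eqP x0 k k_lt].
  apply: contraT; rewrite -lt0n => x_gt0; have minL := diag_labels w (crow x.1).
  have := x_min (pos (diag (crow x.1), 0)); rewrite (ltn_pos R) // poskey_diag_lt //.
  move/(_ (crow_le_ccol _)); rewrite ltnNge ltnW // (ltn_nth_pos R) //.
  by rewrite valkey_diag_lt.
have [y yL pos_y] := label_onto (ltn_trans k_lt (pos_ltn_size R xL)).
move: k_lt (xL); rewrite mem_labels -pos_y (ltn_pos R) // (ltn_nth_pos R) //.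
rewrite poskey_lt valkey_lt -!val_eqE x0 /=.
by have := crow_le_ccol y.1; lia.
Qed.

Lemma lrmin_pos_realized : lrmin_pos s = [seq pos (diag j, 0) | j <- enum 'I_n].
Proof.
apply: (irr_sorted_eq ltn_trans ltnn (sorted_lrmin_pos s)).
  rewrite sorted_map; apply: (@sub_sorted _ (relpre val ltn)); last first.
    by rewrite -sorted_map val_enum_ord iota_ltn_sorted.
  by move=> i j /= ij; rewrite (ltn_pos R) ?diag_labels // poskey_lt /= ij.
move=> k; rewrite mem_lrmin_pos; apply/andP/mapP => [[ks]|[j _ ->]].
  have [[c t] xL <-] := label_onto ks; rewrite is_lrmin_pos // => /eqP /= t0.
  exists (crow c); rewrite ?mem_enum // t0 in xL *; congr (pos (_, 0)).
  by move: xL; rewrite mem_labels /= => /eqP row_c; apply: cell_eq; rewrite //= row_c.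
by rewrite (pos_ltn_size R) ?is_lrmin_pos ?diag_labels.
Qed.

Lemma size_lrmin_pos_realized : size (lrmin_pos s) = n.
Proof. by rewrite lrmin_pos_realized size_map size_enum_ord. Qed.

Lemma minpos_realized (j : 'I_n) : minpos s j = pos (diag j, 0).
Proof.
by rewrite /minpos lrmin_pos_realized (nth_map j) ?size_enum_ord // nth_ord_enum.
Qed.

Lemma nonmin_pos (x : cell n * nat) : x \in labels w -> nonmin s (pos x) = (0 < x.2).
Proof. by move=> xL; rewrite /nonmin (pos_ltn_size R) // is_lrmin_pos // lt0n. Qed.

Lemma entry_row_pos (x : cell n * nat) :
  x \in labels w -> 0 < x.2 -> entry_row s (pos x) = crow x.1.
Proof.
move=> xL x_gt0; have row_lt : entry_row s (pos x) < n.
  by rewrite -size_lrmin_pos_realized entry_row_ltn ?nonmin_pos.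
have row_leE (j : 'I_n) : (entry_row s (pos x) <= j) = (crow x.1 <= j).
  rewrite leq_entry_row ?size_lrmin_pos_realized // minpos_realized.
  by rewrite (ltn_nth_pos R) ?diag_labels // valkey_diag_lt.
apply/eqP; rewrite eqn_leq row_leE leqnn.
by rewrite -(row_leE (Ordinal row_lt)) leqnn.
Qed.

Lemma entry_col_pos (x : cell n * nat) :
  x \in labels w -> 0 < x.2 -> entry_col s (pos x) = ccol x.1.
Proof.
move=> xL x_gt0; have col_lt : entry_col s (pos x) < n.
  by rewrite -size_lrmin_pos_realized entry_col_ltn ?nonmin_pos.
have col_geE (j : 'I_n) : (j <= entry_col s (pos x)) = (j <= ccol x.1).
  rewrite leq_entry_col ?nonmin_pos ?size_lrmin_pos_realized // minpos_realized.
  by rewrite (ltn_pos R) ?diag_labels // poskey_diag_lt.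
apply/eqP; rewrite eqn_leq col_geE leqnn andbT.
by rewrite -(col_geE (Ordinal col_lt)) leqnn.
Qed.

Lemma increasing_rows_realized : increasing_rows s.
Proof.
move=> k l /[dup] k_nmin /andP[/label_onto[x xL pos_x] _].
move=> /[dup] l_nmin /andP[/label_onto[y yL pos_y] _].
move: k_nmin l_nmin; rewrite -pos_x -pos_y !nonmin_pos // => x_gt0 y_gt0.
rewrite !entry_row_pos // !entry_col_pos // (ltn_nth_pos R) // valkey_lt => /val_inj->.
by rewrite eqxx => ->; rewrite orbT.
Qed.

Lemma cell_pos_realized c :
  cell_pos s (crow c) (ccol c) = [seq pos (c, t.+1) | t <- iota 0 (size (w c))].
Proof.
have cL t : t < size (w c) -> (c, t.+1) \in labels w by rewrite mem_labels andbT.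
apply: (irr_sorted_eq ltn_trans ltnn (sorted_cell_pos _ _ _)).
  apply: (homo_sorted_in (P := gtn (size (w c)))) (iota_ltn_sorted 0 (size (w c))).
    by move=> t u /cL tL /cL uL /= tu; rewrite (ltn_pos R) // poskey_lt eqxx ltnS tu orbT.
  by apply/allP => t; rewrite mem_iota.
move=> k; rewrite mem_cell_pos; apply/and3P/mapP => [[]|[t]].
  move=> /[dup] /andP[/label_onto[[d [|u]] dL <-] _]; rewrite nonmin_pos // => _.
  rewrite entry_row_pos ?entry_col_pos // => /eqP row_d /eqP col_d.
  exists u; rewrite -(cell_eq row_d col_d) // mem_iota.
  by move: dL; rewrite mem_labels andbT.
rewrite mem_iota => /cL tL ->.
by rewrite nonmin_pos ?entry_row_pos ?entry_col_pos ?eqxx.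
Qed.

Lemma SE_realized : SE n s = w.
Proof.
apply/ffunP => c; rewrite ffunE cell_entriesE cell_pos_realized -map_comp.
rewrite -[RHS]standardize_id // -[in RHS](mkseq_nth 0 (w c)).
apply: eq_standardize => t u.
rewrite !mem_iota => /= t_lt u_lt; rewrite (ltn_nth_pos R) ?mem_labels ?andbT //.
by rewrite valkey_lt !eqxx !ltnn.
Qed.

End Decode.

Definition staircase_perms n : set (seq nat) :=
  [set s | [/\ is_perm s, size (lrmin_pos s) = n & staircase s]].

Definition independent_fillings n : set (filling n) :=
  [set w : filling n |
    (forall c, is_perm (w c)) /\ independent (@UDC n) (nonempty_cells w)].

Lemma SE_bij n : set_bij (staircase_perms n) (@independent_fillings n) (@SE n).
Proof.
split.
- move=> s [perm_s sn st]; split=> [c|]; first exact/is_perm_SE/is_perm_uniq.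
  by apply/independent_SE/quadrant_row => //; apply: is_perm_uniq.
- move=> s s' /set_mem[perm_s sn st] /set_mem[perm_s' sn' st'] eq_SE.
  have R := realizes_SE perm_s sn st; rewrite eq_SE in R.
  exact: realizes_unique R (realizes_SE perm_s' sn' st').
- move=> w [w_perm indep].
  have [s [pos R]] := realizes_exists (poskey_inj indep) (valkey_inj w_perm).
  have us := is_perm_uniq (realizes_perm R); have sn := size_lrmin_pos_realized w_perm R.
  have SE_s := SE_realized w_perm R.
  exists s => //; split=> //; first exact: realizes_perm R.
  split; last exact: increasing_rows_realized R.
  by apply/(independent_SE us sn); rewrite SE_s.
Qed.

(** * Avoiders and fillings *)

Lemma sub_set_bij (aT rT : Type) (A A' : set aT) (B B' : set rT) (f : aT -> rT) :
  set_bij A B f -> A' `<=` A -> B' `<=` B -> (forall x, A x -> A' x <-> B' (f x)) ->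
  set_bij A' B' f.
Proof.
move=> [_ f_inj f_surj] sub_A sub_B iff_f; split.
- by move=> x A'x; apply/iff_f => //; apply: sub_A.
- by apply: sub_in2 f_inj => x; rewrite !inE; apply: sub_A.
- move=> y B'y; have [x Ax f_x] := f_surj y (sub_B y B'y).
  by exists x => //; apply/iff_f; rewrite ?f_x.
Qed.

Lemma sub_Av (Q Q' : set (seq nat)) :
  (forall q, Q q -> exists2 q', Q' q' & contains q q') -> Av Q' `<=` Av Q.
Proof.
move=> sub_Q s [perm_s avoids]; split=> // q /sub_Q[q' Q'q' q_q'] s_q.
exact: avoids Q'q' (contains_trans s_q q_q').
Qed.

Lemma contains_refl q : contains q q.
Proof. by exists q. Qed.

Lemma basis_perm p : basis p -> is_perm p /\ p <> [::].
Proof. by case=> [[]|] ->. Qed.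

Lemma basis_bar_indecomposable p : basis p -> sum_indecomposable (bar p).
Proof. by case=> [[]|] ->; apply: sum_indecomposable_take. Qed.

Lemma contains_312_bar_basis p : basis p -> contains (bar p) [:: 3; 1; 2].
Proof.
case=> [[]|] ->; apply/containsE => //.
- by exists [:: 4; 1; 3].
- by exists [:: 3; 1; 2].
- by exists [:: 3; 1; 2].
Qed.

Lemma Avp_312_bar (P : set (seq nat)) :
  Avp ([set [:: 3; 1; 2]] `|` (bar @` P)) = Avp (bar @` (basis `|` P)).
Proof.
apply/seteqP; split=> s [s_av s_neq0]; split=> //; apply: sub_Av s_av => q.
  case=> p [basis_p|Pp] <-.
    by exists [:: 3; 1; 2]; [left | exact: contains_312_bar_basis].
  by exists (bar p); [right; exists p | exact: contains_refl].
move=> q_bar; exists q; last exact: contains_refl.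
case: q_bar => [->|[p Pp <-]]; last by exists p; [right |].
by exists [:: 3; 1; 2; 4]; [left; right |].
Qed.

Lemma Av_rows (P : set (seq nat)) s :
  (forall p, P p -> is_perm p /\ p <> [::]) -> is_perm s -> staircase s ->
  Av (basis `|` (oplus [:: 1] @` P)) s <->
  forall p, (basis `|` P) p -> forall i, ~ occurs_in s (in_row s i) p.
Proof.
move=> P_perm perm_s st; have us := is_perm_uniq perm_s; split=> [[_ avoids] p|avoids].
  case=> [basis_p|Pp] i occ.
    apply: (avoids p); first by left.
    by apply: occurs_in_row_contains occ; case: (basis_perm basis_p).
  have [perm_p p_neq0] := P_perm p Pp.
  apply: (avoids (oplus [:: 1] p)); first by right; exists p.
  exact: occurs_in_row_contains_oplus1 occ.
split=> // q [basis_q|[p Pp <-]].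
  by move=> /(contains_basis_occurs_in_row us st basis_q)[i]; apply: avoids; left.
have [perm_p p_neq0] := P_perm p Pp.
by move=> /(contains_oplus1_occurs_in_row us st perm_p p_neq0)[i]; apply: avoids; right.
Qed.

Theorem theorem7p3 (P : set (seq nat))
    (P_perm : forall p, P p -> is_perm p /\ p <> [::])
    (P_indec : forall p, (bar @` P) p -> sum_indecomposable p)
    (n : nat) :
  set_bij
    (Avn n ([set [:: 2; 4; 1; 3]; [:: 3; 1; 4; 2]; [:: 3; 1; 2; 4]]
            `|` (oplus [:: 1] @` P)))
    (WI (@rho n) (@UDC n)
       (Avp ([set [:: 3; 1; 2]] `|` (bar @` P)))
       (Avp ([set [:: 2; 4; 1; 3]; [:: 3; 1; 4; 2]; [:: 3; 1; 2; 4]] `|` P)))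
    (@SE n).
Proof.
rewrite -/basis Avp_312_bar.
have B_perm p : (basis `|` P) p -> is_perm p /\ p <> [::].
  by case; [exact: basis_perm | exact: P_perm].
have B_indec p : (basis `|` P) p -> sum_indecomposable (bar p).
  by case=> [/basis_bar_indecomposable//|Pp]; apply: P_indec; exists p.
apply: (sub_set_bij (SE_bij n)).
- move=> s [[perm_s avoids] sn]; split=> //.
  apply: avoids_basis_staircase; first exact: is_perm_uniq.
  by move=> p basis_p; apply: avoids; left.
- move=> w [indep contents]; split=> // c; have [->//|w_neq0] := eqVneq (w c) [::].
  by have := contents c; rewrite inE w_neq0 => /(_ isT); case: rho => -[[]].
- move=> s [perm_s sn st]; have us := is_perm_uniq perm_s.
  rewrite (WI_SE_rows us sn st B_perm B_indec) -(Av_rows P_perm perm_s st).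
  by split=> [[]|].
Qed.
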